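(* Let $A$ be a finite alphabet with $|A| = a$, let $n$ be a positive integer, and let $w$ be a pseudocyclic universal partial word for $A^n$ with diamondicity $d$. Let $f$ be the first window frame of $w$, and let $i$ be the length of the shortest word $f'$ such that $f = (f')^s$ for some positive integer $s$. Then $i$ divides $\gcd(a^{n-d}, n)$.
   Context: A partial word over $A$ is a finite sequence of characters from $A \cup \{\diamond\}$, where $\diamond \notin A$ is a wild-card symbol; a word over $A$ contains no $\diamond$. $A^n$ denotes the set of words of length $n$ over $A$. For $x = x_1\cdots x_n \in A^n$ and a partial word $w = w_1\cdots w_N$, the position $i$ ($0 \le i \le N-n$) covers $x$ if $x_j = w_{i+j}$ for every $1\le j\le n$ with $w_{i+j}\in A$. A universal partial word for $A^n$ is a partial word $w$ such that every word in $A^n$ is covered by exactly one position of $w$. A window is a string of $n$ consecutive characters of $w$; the frame of a partial word is obtained by replacing each letter of $A$ by the symbol $\_$, and the first window frame is the frame of $w_1\cdots w_n$. $w$ is pseudocyclic if its first $n-1$ characters equal its last $n-1$ characters as strings over $A\cup\{\diamond\}$ (possibly overlapping). For pseudocyclic universal partial words every window contains the same number $d$ of $\diamond$'s, called the diamondicity. $(f')^s$ denotes the concatenation of $s$ copies of $f'$. *)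

(* Defs.v *)
From mathcomp Require Import all_boot.

Set Implicit Arguments.
Unset Strict Implicit.
Unset Printing Implicit Defensive.

(* [None] is the wild-card symbol. *)
Notation pword A := (seq (option A)).

Section PartialWords.
Variable A : finType.
Implicit Types (w : pword A) (n i d : nat).

Definition covers n w i (x : n.-tuple A) : Prop :=
  i + n <= size w /\
  forall (j : 'I_n) (b : A), nth None w (i + j) = Some b -> tnth x j = b.

Definition universal n w : Prop :=
  forall x : n.-tuple A, exists! i, covers w i x.

Definition window n w i : pword A := take n (drop i w).

Definition pseudocyclic n w : Prop :=
  take n.-1 w = drop (size w - n.-1) w.

(* The bound [n <= size w] says that [w] has a window at all. It holds for
   every universal [w] over a nonempty alphabet; over the empty alphabet it
   excludes words that are too short to have a first window. *)
Definition diamondicity n w d : Prop :=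
  n <= size w /\
  forall i, i + n <= size w -> count (pred1 None) (window n w i) = d.

(* A frame is a partial word over the one-letter alphabet [unit], whose
   letter plays the role of the underscore. *)
Definition frame w : pword unit := map (omap (fun=> tt)) w.

Definition first_window_frame n w : pword unit := frame (window n w 0).

End PartialWords.

Definition power_of (T : Type) (f g : seq T) : Prop :=
  exists2 s : nat, 0 < s & f = flatten (nseq s g).

Definition shortest_root_length (T : Type) (f : seq T) (i : nat) : Prop :=
  (exists2 g : seq T, power_of f g & size g = i) /\
  forall g : seq T, power_of f g -> i <= size g.

(* Main.v *)
Require Import Defs.
From mathcomp Require Import all_boot.
From mathcomp Require Import zify.

Set Implicit Arguments.
Unset Strict Implicit.
Unset Printing Implicit Defensive.

(** Two consecutive windows of [w] contain equally many diamonds, so the frame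
    of [w] is [n]-periodic. Each of the [M] windows covers [a ^ d] words, hence
    [M * a ^ d = a ^ n] and [M = a ^ (n - d)]. Pseudocyclicity says that the
    frame agrees with its shift by [M] on [n - 1] consecutive places; since
    every [n] consecutive places contain [d] diamonds, it agrees on the [n]-th
    one too, so the [n]-periodic extension of the first window frame also has
    period [M]. The length [i] of the shortest root is a further period, and by
    minimality it divides [gcd (M, n)]. *)

Lemma periodM (T : Type) (P : nat -> T) p :
  (forall j, P (j + p) = P j) -> forall k j, P (j + k * p) = P j.
Proof.
move=> Pp; elim=> [|k IHk] j; first by rewrite addn0.
by rewrite mulSnr addnA Pp IHk.
Qed.

(** Bezout without subtraction: [u * p = v * q + gcdn p q], so moving on from [j + gcdn p q] by [v]
    periods [q] lands [u] periods [p] past [j]. *)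
Lemma period_gcd (T : Type) (P : nat -> T) p q :
  0 < p -> (forall j, P (j + p) = P j) -> (forall j, P (j + q) = P j) ->
  forall j, P (j + gcdn p q) = P j.
Proof.
move=> p_gt0 Pp Pq j; case: (egcdnP q p_gt0) => u v Euv _.
by rewrite -(periodM Pq v) -addnA [gcdn _ _ + _]addnC -Euv (periodM Pp).
Qed.

Lemma size_flatten_nseq (T : Type) s (g : seq T) :
  size (flatten (nseq s g)) = s * size g.
Proof. by elim: s => //= s IHs; rewrite size_cat IHs mulSn. Qed.

Lemma nth_flatten_nseq (T : Type) (x0 : T) s (g : seq T) j :
  j < s * size g -> nth x0 (flatten (nseq s g)) j = nth x0 g (j %% size g).
Proof.
elim: s j => //= s IHs j; rewrite mulSn nth_cat => lt_j.
case: ltnP => [lt_jg | le_gj]; first by rewrite modn_small.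
rewrite IHs; first by rewrite -[in RHS](subnK le_gj) modnDr.
by rewrite ltn_subLR.
Qed.

Lemma power_of_period (T : Type) (x0 : T) (f : seq T) p :
  0 < size f -> p %| size f ->
  (forall j, nth x0 f ((j + p) %% size f) = nth x0 f (j %% size f)) ->
  power_of f (take p f).
Proof.
move=> f_gt0 dvd_p Pp; have p_gt0 := dvdn_gt0 f_gt0 dvd_p.
have size_g : size (take p f) = p by rewrite size_takel // dvdn_leq.
exists (size f %/ p); first by rewrite divn_gt0 // dvdn_leq.
apply: (@eq_from_nth _ x0) => [|j lt_j].
  by rewrite size_flatten_nseq size_g divnK.
rewrite nth_flatten_nseq size_g ?divnK // nth_take ?ltn_pmod //.
rewrite -{1}(modn_small lt_j) {1}(divn_eq j p) addnC.
rewrite (periodM (P := fun j => nth x0 f (j %% size f)) Pp) modn_small //.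
by rewrite (leq_ltn_trans (leq_mod j p)).
Qed.

Lemma power_of_shift (T : Type) (x0 : T) (f g : seq T) :
  0 < size f -> power_of f g ->
  forall j, nth x0 f ((j + size g) %% size f) = nth x0 f (j %% size f).
Proof.
move=> f_gt0 [s _ Ef] j.
have size_f : size f = s * size g by rewrite Ef size_flatten_nseq.
have nthf k : nth x0 f (k %% size f) = nth x0 g (k %% size g).
  rewrite {1}Ef nth_flatten_nseq; last by rewrite -size_f ltn_pmod.
  by rewrite size_f modn_dvdm // dvdn_mull.
by rewrite !nthf modnDr.
Qed.

(** With [g] a shortest root, [gcdn (size g) M] is again a cyclic period dividing [size f], so the
    prefix of that length is a root. Minimality forces it to equal [size g], whence [size g] divides
    [M]. *)
Lemma shortest_root_length_dvd (T : Type) (x0 : T) (f : seq T) i M :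
  0 < size f -> shortest_root_length f i ->
  (forall j, nth x0 f ((j + M) %% size f) = nth x0 f (j %% size f)) ->
  i %| gcdn M (size f).
Proof.
move=> f_gt0 [[g fg <-] min_g] PM.
have dvd_g : size g %| size f.
  by case: fg => s _ ->; rewrite size_flatten_nseq dvdn_mull.
have g_gt0 := dvdn_gt0 f_gt0 dvd_g.
rewrite dvdn_gcd dvd_g andbT; apply/gcdn_idPl/eqP.
rewrite eqn_leq dvdn_leq ?dvdn_gcdl //=.
have Pgcd := period_gcd (P := fun j => nth x0 f (j %% size f)) g_gt0
  (power_of_shift x0 f_gt0 fg) PM.
have dvd_gcd : gcdn (size g) M %| size f.
  exact: dvdn_trans (dvdn_gcdl _ _) dvd_g.
have := min_g _ (power_of_period f_gt0 dvd_gcd Pgcd).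
by rewrite size_takel // dvdn_leq.
Qed.

Lemma count_nth_sum (T : Type) (x0 : T) (a : pred T) (s : seq T) :
  count a s = \sum_(j < size s) a (nth x0 s j).
Proof. by rewrite -sum1_count big_mkcond (big_nth x0) big_mkord. Qed.

(** Both sides sum [c] over the [n + 1] places from [i] to [i + n]. *)
Lemma sum_window_shift (c : nat -> nat) n i :
  \sum_(j < n) c (i.+1 + j) + c i = \sum_(j < n) c (i + j) + c (i + n).
Proof.
rewrite -(big_ord_recr n (fun j => c (i + j))) big_ord_recl /= addn0 addnC.
by congr (_ + _); apply: eq_bigr => j _; rewrite addSnnS.
Qed.

Lemma sum_full_period (c : nat -> nat) n :
  (forall j, c (j + n) = c j) ->
  forall i, \sum_(j < n) c (i + j) = \sum_(j < n) c j.
Proof.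
by move=> cn; elim=> // i <-; have := sum_window_shift c n i; rewrite cn; lia.
Qed.

Lemma sum_nat_ex1 N (P : pred nat) :
  (exists! k, k < N /\ P k) -> \sum_(k < N) P k = 1.
Proof.
case=> k [[lt_k Pk] uniq_k]; rewrite (bigD1 (Ordinal lt_k)) //= Pk big1 // => l.
apply: contraNeq; rewrite eqb0 negbK => Pl.
by apply/eqP/val_inj; rewrite /= (uniq_k l).
Qed.

Section Windows.
Variables (A : finType) (n : nat) (w : pword A) (d : nat).
Hypotheses (n_gt0 : 0 < n) (wd : diamondicity n w d).

(** Places beyond the end of [w] also count as diamonds, since [None] is the default; hence the
    bounds by [size w] below. *)
Let c j : nat := nth None w j == None.

Lemma sum_diamonds_window i : i + n <= size w -> \sum_(j < n) c (i + j) = d.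
Proof.
move=> le_iw; have [_ /(_ i le_iw) <-] := wd.
have size_win : size (window n w i) = n.
  by rewrite size_takel // size_drop leq_subRL // (leq_trans _ le_iw) ?leq_addr.
rewrite (count_nth_sum None) size_win; apply: eq_bigr => j _.
by rewrite nth_take // nth_drop.
Qed.

Lemma diamond_modn j : j < size w -> c j = c (j %% n).
Proof.
elim/ltn_ind: j => j IHj lt_jw; case: (ltnP j n) => [lt_jn | le_nj].
  by rewrite modn_small.
(* The windows at [j - n] and [j - n + 1] differ only in losing place [j - n] and gaining place
   [j]. *)
have cj : c (j - n) = c j.
  have := sum_window_shift c n (j - n).
  rewrite !sum_diamonds_window ?subnK //; try lia.
by rewrite -cj IHj; [rewrite -[in RHS](subnK le_nj) modnDr | lia | lia].
Qed.

(** The words covered at [i] form a product of singletons, one per letter, and copies of [A], one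
    per diamond. *)
Let fits i (j : 'I_n) : pred A :=
  if nth None w (i + j) is Some b then pred1 b else predT.

Lemma card_fits i : i + n <= size w -> #|family (fits i)| = #|A| ^ d.
Proof.
move=> le_iw; rewrite card_family foldrE big_map big_enum /=.
rewrite -(sum_diamonds_window le_iw) expn_sum; apply: eq_bigr => j _.
by rewrite /fits /c; case: (nth _ _ _) => [b|]; rewrite ?card1.
Qed.

Lemma coversE i (f : {ffun 'I_n -> A}) :
  covers w i [tuple f j | j < n] <-> i + n <= size w /\ f \in family (fits i).
Proof.
split=> -[le_iw cov]; split=> //.
  apply/familyP=> j; rewrite /fits.
  case E: (nth _ _ _) => [b|] //; rewrite inE -(cov j b E).
  by rewrite tnth_mktuple.
move=> j b E; move/familyP: cov => /(_ j).
by rewrite tnth_mktuple /fits E inE => /eqP.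
Qed.

(** Double counting of the pairs of a position and a word covered there; universality gives each
    word exactly one position. *)
Lemma card_windows : universal n w -> (size w - n).+1 * #|A| ^ d = #|A| ^ n.
Proof.
move=> wU; have [le_nw _] := wd.
transitivity #|{ffun 'I_n -> A}|; last by rewrite card_ffun card_ord.
transitivity (\sum_(i < (size w - n).+1) \sum_f (f \in family (fits i))).
  rewrite -[in LHS](card_ord (size w - n).+1) -sum_nat_const.
  apply: eq_bigr => i _; rewrite -(@card_fits i); last by have := ltn_ord i; lia.
  by rewrite -sum1_card big_mkcond.
rewrite exchange_big /= -sum1_card; apply: eq_bigr => f _.
apply: (@sum_nat_ex1 _ (fun i => f \in family (fits i))).
case: (wU [tuple f j | j < n]) => i [/coversE [le_iw fi] uniq_i].
exists i; split=> [|k [lt_k fk]]; first by split=> //; lia.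
by apply: uniq_i; apply/coversE; split=> //; lia.
Qed.

Lemma diamond_period_windows : pseudocyclic n w ->
  forall j, c ((j + (size w - n).+1) %% n) = c (j %% n).
Proof.
move=> wP j; have [le_nw _] := wd; set M := (size w - n).+1.
pose P k := c (k %% n); rewrite -!/(P _).
have Pn k : P (k + n) = P k by rewrite /P modnDr.
(* As [size w - n.-1 = M], the suffix in [pseudocyclic] starts at place [M]. *)
have PM k : k < n.-1 -> P (M + k) = P k.
  move=> lt_k; rewrite /P -!diamond_modn; [|lia|lia].
  rewrite /c -[in RHS](nth_take None lt_k) wP nth_drop.
  by congr (nat_of_bool (nth _ _ _ == _)); lia.
(* The sums of [P] over the [n] places from [M] and from [0] agree; cancelling the first [n - 1]
   terms leaves the last. *)
have PM_last : P (M + n.-1) = P n.-1.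
  have := sum_full_period Pn M; case: n n_gt0 PM => // m _ PM.
  rewrite !big_ord_recr /= (eq_bigr (fun k : 'I_m => P k)) => [|k _].
    by move/addnI.
  exact: PM.
have -> : P (j + M) = P (M + j %% n) by rewrite /P modnDmr addnC.
have -> : P j = P (j %% n) by rewrite /P modn_mod.
have := ltn_pmod j n_gt0.
rewrite -[X in _ < X -> _](prednK n_gt0) ltnS leq_eqVlt.
by case/predU1P=> [-> | /PM].
Qed.

Lemma diamond_period : universal n w -> pseudocyclic n w ->
  forall j, c ((j + #|A| ^ (n - d)) %% n) = c (j %% n).
Proof.
move=> wU wP j; have [le_nw _] := wd.
(* Over an empty alphabet [#|A| ^ d] may vanish and cannot be cancelled, but then every place is a
   diamond. *)
have [A0 | A_gt0] := posnP #|A|.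
  have cE k : c k = 1.
    by rewrite /c; case: (nth _ _ _) => // b; have := card0_eq A0 b.
  by rewrite !cE.
suff -> : #|A| ^ (n - d) = (size w - n).+1 by apply: diamond_period_windows.
have le_dn : d <= n.
  rewrite -(@sum_diamonds_window 0) // -[leqRHS]card_ord -sum1_card.
  by apply: leq_sum => k _; apply: leq_b1.
apply/eqP; rewrite -(@eqn_pmul2r (#|A| ^ d)) ?expn_gt0 ?A_gt0 //.
by rewrite card_windows // -expnD subnK.
Qed.

End Windows.

Theorem theorem4p11 (A : finType) (n : nat) (w : pword A) (d i : nat) :
  0 < n ->
  universal n w ->
  pseudocyclic n w ->
  diamondicity n w d ->
  shortest_root_length (first_window_frame n w) i ->
  i %| gcdn (#|A| ^ (n - d)) n.
Proof.
move=> n_gt0 wU wP wd root_i; have [le_nw _] := wd.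
have size_win : size (window n w 0) = n by rewrite /window drop0 size_takel.
have size_f : size (first_window_frame n w) = n by rewrite size_map.
rewrite -[n in gcdn _ n]size_f.
apply: (shortest_root_length_dvd (x0 := None) _ root_i) => [|j];
  rewrite size_f //.
(* The frame records only whether a place is a diamond, so it inherits the periods of the diamond
   indicator. *)
have nthf k : nth None (first_window_frame n w) (k %% n) =
    if nth None w (k %% n) == None then None else Some tt.
  rewrite (nth_map None) ?size_win ?ltn_pmod // nth_take ?ltn_pmod // drop0.
  by case: (nth _ _ _).
rewrite !nthf; have := diamond_period n_gt0 wd wU wP j.
by do 2!case: (_ == None).
Qed.
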